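(* Let $G$ be a finite connected simple graph with minimum degree at least $2$ and let $\lambda = \lambda_*(B(G))$. Let $\varepsilon > 0$ and $p \in [\tfrac{1}{\lambda} + \varepsilon, 1]$. If $X$ is a $p$-random subset of $E(G)$, then $X$ contains (the edge set of) a circuit of $G$ with probability at least $\tfrac{\varepsilon^2}{4}$.
   Context: For a graph $G=(V,E)$, let $\overline{E} = \{(u,v) \in V^2 : u \text{ adjacent to } v\}$ be the set of $2|E|$ arcs. Let $B = B(G) \in \{0,1\}^{\overline{E}\times\overline{E}}$ be the matrix with $B_{(u,v),(u',v')} = 1$ if and only if $u' = v$ and $u \ne v'$. For $G$ connected of minimum degree at least $2$, $B$ is the adjacency matrix of a strongly connected digraph, and $\lambda_*(B(G))$ denotes its Perron–Frobenius eigenvalue, i.e. the positive real eigenvalue of $B$ of maximum modulus (its spectral radius). A $p$-random subset of $E(G)$ is obtained by including each edge independently with probability $p$. A circuit is a cycle of $G$. *)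

(* Defs.v *)
From mathcomp Require Import all_boot all_order all_algebra.
From mathcomp Require Import complex.
From mathcomp Require Import boolp classical_sets reals.

Set Implicit Arguments.
Unset Strict Implicit.
Unset Printing Implicit Defensive.

Import Order.TTheory GRing.Theory Num.Theory.
Local Open Scope ring_scope.
Local Open Scope complex_scope.

Section Graphs.

Variables (T : finType) (e : rel T).

Definition simple_graph : Prop := symmetric e /\ irreflexive e.

Definition connected_graph : Prop :=
  (0 < #|T|)%N /\ forall x y : T, connect e x y.

Definition degree (x : T) : nat := #|[set y | e x y]|.

Definition min_degree_ge (d : nat) : Prop := forall x : T, (d <= degree x)%N.

(* An edge is the unordered pair of its endpoints. *)
Definition edges : {set {set T}} :=
  [set [set a.1; a.2] | a in [set a : T * T | e a.1 a.2]].

Definition arc : finType := {a : T * T | e a.1 a.2}.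

Definition nonbacktracking (a b : arc) : bool :=
  ((val b).1 == (val a).2) && ((val a).1 != (val b).2).

Definition nb_matrix (R : nzRingType) : 'M[R]_#|arc| :=
  \matrix_(i, j) (nonbacktracking (enum_val i) (enum_val j))%:R.

(* A circuit is listed by its vertices in cyclic order; [next c x] is the
   successor of [x] on it. *)
Definition circuit (c : seq T) : Prop := (3 <= size c)%N /\ ucycle e c.

Definition circuit_edges (c : seq T) : {set {set T}} :=
  [set [set x; next c x] | x in c].

Definition contains_circuit (X : {set {set T}}) : Prop :=
  exists2 c : seq T, circuit c & circuit_edges c \subset X.

End Graphs.

Section Perron.

Variables (R : realType) (n : nat).

Definition is_perron_eigenvalue (A : 'M[R]_n) (l : R) : Prop :=
  let AC : 'M[R[i]]_n := map_mx (real_complex R) A in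
  [/\ 0 < l,
      eigenvalue AC l%:C &
      forall mu : R[i], eigenvalue AC mu -> `|mu| <= `|l%:C| ].

Lemma is_perron_eigenvalue_uniq (A : 'M[R]_n) (l l' : R) :
  is_perron_eigenvalue A l -> is_perron_eigenvalue A l' -> l = l'.
Proof.
move=> [l0 el ml] [l'0 el' ml'].
have := ml _ el'; have := ml' _ el.
rewrite !ger0_norm ?lecR ?(ltW l0) ?(ltW l'0) // => h1 h2.
by apply/le_anti; rewrite h1 h2.
Qed.

(* Junk value 0 when no such eigenvalue exists. *)
Definition perron_eigenvalue (A : 'M[R]_n) : R :=
  xget 0 [set l | is_perron_eigenvalue A l]%classic.

End Perron.

(* Probability of the event [Q] for a random subset of [E] in which each
   element of [E] is included independently with probability [p]. *)
Definition random_subset_prob (R : realType) (U : finType) (E : {set U}) (p : R)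
    (Q : {set U} -> Prop) : R :=
  \sum_(X : {set U} | (X \subset E) && `[< Q X >])
    \prod_(f in E) (if f \in X then p else 1 - p).

(* Main.v *)
(* Split the exposure of the edges into two rounds, the first one with
   probability [p1 = p - eps / 2 >= 1 / lambda + eps / 2].  Until it reaches a
   vertex with two neighbours in the explored tree, the first-round exploration
   from an arc is a branching process in which an arc is followed by its
   nonbacktracking continuations.  A nonnegative vector [u <= 1] with
   [B u >= lambda u] makes [(eps / 2) u] a subsolution of the equation for the
   survival probabilities (times [p1]), so that the process survives with
   probability at least [eps / 2] from a suitable arc; as the graph is finite, it
   then has to stop, and the edge at which it stops closes a circuit if it is
   opened in the second round, which has probability at least [eps / 2].

   The Perron eigenvalue is the supremum of the [t] such that [x A >= t x] for
   some nonzero [x >= 0].  Irreducibility is not available to identify it: [B] is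
   reducible when the graph is a cycle. *)

Require Import Defs.
From mathcomp Require Import all_boot all_order all_algebra.
From mathcomp Require Import complex.
From mathcomp Require Import boolp classical_sets reals.
From mathcomp Require Import ring lra.

Import Order.TTheory GRing.Theory Num.Theory.
Local Open Scope ring_scope.

(** * Perron eigenvalue of a nonnegative matrix *)

Definition l1norm {R : realType} {n : nat} (x : 'rV[R]_n) : R :=
  \sum_j `|x 0 j|.

(** These [t] are Collatz-Wielandt lower bounds; row vectors match the convention of
    [eigenvalue]. *)
Definition subinvariant {R : realType} {n : nat} (A : 'M[R]_n) (t : R)
    (x : 'rV[R]_n) : Prop :=
  [/\ forall j, 0 <= x 0 j, x != 0 & forall j, t * x 0 j <= (x *m A) 0 j].

Lemma l1norm_gt0 (R : realType) (n : nat) (x : 'rV[R]_n) :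
  x != 0 -> 0 < l1norm x.
Proof.
case/rV0Pn => j xj; rewrite /l1norm (bigD1 j) //=.
by rewrite ltr_pwDl ?normr_gt0 ?sumr_ge0.
Qed.

Lemma l1norm_mulmx (R : realType) (n : nat) (x : 'rV[R]_n) (A : 'M[R]_n) :
  l1norm (x *m A) <= l1norm x * \sum_i \sum_j `|A i j|.
Proof.
apply: (@le_trans _ _ (\sum_j \sum_i `|x 0 i| * `|A i j|)).
  apply: ler_sum => j _; rewrite mxE (le_trans (ler_norm_sum _ _ _)) //.
  by apply: ler_sum => i _; rewrite normrM.
rewrite exchange_big /= /l1norm mulr_suml; apply: ler_sum => i _.
rewrite -mulr_sumr ler_wpM2l // [leRHS](bigD1 i) //= lerDl.
by apply: sumr_ge0 => k _; apply: sumr_ge0.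
Qed.

Lemma subinvariant_le (R : realType) (n : nat) (A : 'M[R]_n) (t : R) (x : 'rV_n) :
  subinvariant A t x -> t <= \sum_i \sum_j `|A i j|.
Proof.
case=> x0 xn0 tx; rewrite -(ler_pM2l (l1norm_gt0 _ _ _ xn0)).
apply: le_trans (l1norm_mulmx _ _ _ _).
rewrite mulrC /l1norm mulr_sumr; apply: ler_sum => j _.
by rewrite (ger0_norm (x0 j)) (le_trans (tx j)) // ler_norm.
Qed.

(* The negative part of a vector violating the conclusion would be
   subinvariant. *)
Lemma inverse_monotone (R : realType) (n : nat) (A : 'M[R]_n) (t : R)
    (y : 'rV_n) :
  (forall i j, 0 <= A i j) -> ~ (exists x, subinvariant A t x) ->
  (forall j, 0 <= (y *m (t%:M - A)) 0 j) -> forall j, 0 <= y 0 j.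
Proof.
move=> A0 Nt yM j; rewrite leNgt; apply/negP => yj; apply: Nt.
have xE k : (\row_k Num.max 0 (- y 0 k)) 0 k = Num.max 0 (- y 0 k) by rewrite mxE.
exists (\row_k Num.max 0 (- y 0 k)); split.
- by move=> k; rewrite xE le_max lexx.
- apply/rV0Pn; exists j; rewrite xE; apply/lt0r_neq0.
  by rewrite lt_max oppr_gt0 yj orbT.
move=> k; have := yM k; rewrite mulmxBr mul_mx_scalar !mxE subr_ge0 => yA.
have [yk|yk] := leP 0 (y 0 k).
  rewrite max_l ?oppr_le0 // mulr0 sumr_ge0 // => i _.
  by rewrite xE mulr_ge0 // le_max lexx.
rewrite max_r; last by rewrite oppr_ge0 ltW.
rewrite mulrN lerNl (le_trans _ yA) // -sumrN; apply: ler_sum => i _.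
by rewrite xE -mulNr ler_wpM2r // lerNl le_max lexx orbT.
Qed.

(* If [r - A] were invertible at the supremum [r], then for [s < r < t] close to
   [r] and [x] subinvariant at [s], the solution [y] of [y (t - A) = x] would be
   bounded by a multiple of [x], whereas monotonicity of [(t - A)^-1] gives
   [x <= (t - s) y]. *)
Lemma subinvariant_sup_eigenvalue (R : realType) (n : nat) (A : 'M[R]_n) (r : R) :
  (forall i j, 0 <= A i j) ->
  (forall t x, subinvariant A t x -> t <= r) ->
  (forall d, 0 < d -> exists s, r - d < s /\ exists x, subinvariant A s x) ->
  eigenvalue A r.
Proof.
move=> A0 ub adh; have [//|/negP Neig] := boolP (eigenvalue A r).
have Mu : r%:M - A \in unitmx.
  rewrite -row_free_unit; apply: inj_row_free => v vM.
  apply/eqP/negPn/negP => v0; apply: Neig; apply/eigenvalueP; exists v => //.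
  by apply/esym/eqP; rewrite -subr_eq0 -mul_mx_scalar -mulmxBr vM.
pose C : R := 1 + \sum_i \sum_j `|invmx (r%:M - A) i j|.
have C0 : 0 < C.
  by rewrite ltr_pwDl // sumr_ge0 // => i _; apply: sumr_ge0.
(* With [d * C = 1 / 4], the two norm bounds below combine to the absurd
   [l1norm y <= 3 / 4 * l1norm y]. *)
pose d := (4 * C)^-1; have d0 : 0 < d by rewrite invr_gt0 mulr_gt0.
have dC : d * C = 1 / 4 by rewrite /d; field; rewrite gt_eqF.
have [s [rs [x sx]]] := adh _ d0; have [x0 xn0 xA] := sx.
have sr := ub _ _ sx; pose t := r + d.
have Nt : ~ exists x', subinvariant A t x'.
  by case=> x' /ub; rewrite /t gerDl leNgt d0.
have mono y := inverse_monotone _ _ A t y A0 Nt.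
(* [mono] applies to both [v] and [- v], so a kernel vector vanishes. *)
have Mt : t%:M - A \in unitmx.
  rewrite -row_free_unit; apply: inj_row_free => v vM.
  apply/rowP => j; rewrite mxE; apply/le_anti; apply/andP; split.
    rewrite -oppr_ge0; have := mono (- v); rewrite mulNmx vM.
    by move/(_ _ j); rewrite mxE; apply=> k; rewrite !mxE oppr0.
  by apply: mono => k; rewrite vM mxE.
have [y yM] : exists y, y *m (t%:M - A) = x.
  by exists (x *m invmx (t%:M - A)); rewrite mulmxKV.
have y0 : forall j, 0 <= y 0 j by apply: mono => j; rewrite yM.
(* The image under [t%:M - A] is [x *m A - s *: x], nonnegative by subinvariance. *)
have xy : forall j, 0 <= ((t - s) *: y - x) 0 j.
  apply: mono => j; rewrite mulmxBl -scalemxAl yM mulmxBr mul_mx_scalar.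
  by have := xA j; rewrite !mxE; set a := \sum_(_ <- _) _; lra.
have yE : y = (x - d *: y) *m invmx (r%:M - A).
  rewrite -[LHS](mulmxK Mu); congr (_ *m _).
  rewrite -yM /t !mulmxBr !mul_mx_scalar scalerDl.
  by apply/rowP => k; rewrite !mxE; ring.
have ny : l1norm y <= (l1norm x + d * l1norm y) * C.
  rewrite {1}yE (le_trans (l1norm_mulmx _ _ _ _)) //.
  apply: ler_pM; [exact: sumr_ge0| | |by rewrite lerDr].
    by apply: sumr_ge0 => i _; apply: sumr_ge0.
  rewrite /l1norm mulr_sumr -big_split /=; apply: ler_sum => j _.
  by rewrite !mxE (le_trans (ler_normB _ _)) // normrM (gtr0_norm d0).
have nx : l1norm x <= 2 * d * l1norm y.
  rewrite /l1norm mulr_sumr; apply: ler_sum => j _.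
  have := xy j; rewrite !mxE !ger0_norm // subr_ge0 => /le_trans; apply.
  by rewrite ler_wpM2r // /t; lra.
have := l1norm_gt0 _ _ _ xn0; set X := l1norm x in ny nx *.
set Y := l1norm y in ny nx *; move=> X0.
have XC : X * C <= 2 * (d * C) * Y by rewrite mulrA mulrAC ler_wpM2r // ltW.
have dY : d * Y * C = (d * C) * Y by ring.
have Y0 : 0 < Y.
  by rewrite -(pmulr_rgt0 _ (mulr_gt0 (ltr0n _ 2) d0)) (lt_le_trans X0).
by move: ny; rewrite mulrDl dY; rewrite dC in XC *; lra.
Qed.

(** By the triangle inequality, the moduli of the coordinates of a left eigenvector work. *)
Lemma eigenvalue_subinvariant (R : realType) (n : nat) (A : 'M[R]_n) (mu : R[i]) :
  (forall i j, 0 <= A i j) -> eigenvalue (map_mx (real_complex R) A) mu ->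
  exists x, subinvariant A (complex.Re `|mu|) x.
Proof.
move=> A0 /eigenvalueP[v vA v0].
have normE (z : R[i]) : `|z| = ((complex.Re `|z|)%:C)%C.
  exact/esym/RRe_real/normr_real.
exists (\row_j complex.Re `|v 0 j|); split.
- by move=> j; rewrite mxE -ler0c -normE.
- case/rV0Pn: v0 => j vj; apply/rV0Pn; exists j; rewrite mxE.
  by apply: contra vj => /eqP vj; rewrite -normr_eq0 normE vj.
move=> j; rewrite !mxE -lecR rmorphM rmorph_sum /= -!normE -normrM.
have /rowP/(_ j) := vA; rewrite !mxE => <-.
apply: le_trans (ler_norm_sum _ _ _) _; apply: ler_sum => i _.
rewrite !mxE normrM rmorphM /= -normE.
by rewrite (@ger0_norm _ ((A i j)%:C)%C) // lecR.
Qed.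

(** The hypothesis at [1] makes the supremum positive; moduli of complex eigenvalues lie below it,
    being subinvariant values themselves. *)
Lemma perron_eigenvalue_exists (R : realType) (n : nat) (A : 'M[R]_n) :
  (forall i j, 0 <= A i j) -> (exists x, subinvariant A 1 x) ->
  exists l, is_perron_eigenvalue A l.
Proof.
move=> A0 S1; pose S := [set t | exists x, subinvariant A t x]%classic.
have supS : has_sup S.
  split; first by exists 1.
  by exists (\sum_i \sum_j `|A i j|) => t [x]; apply: subinvariant_le.
have ub t x : subinvariant A t x -> t <= sup S.
  by move=> tx; apply: sup_upper_bound => //; exists x.
have S0 : 0 < sup S by case: S1 => x /ub; apply: lt_le_trans.
exists (sup S); split=> //.
  rewrite eigenvalue_map; apply: subinvariant_sup_eigenvalue => // d d0.
  by have [s Ss ds] := sup_adherent d0 supS; exists s.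
move=> mu /(eigenvalue_subinvariant _ _ _ _ A0)[x /ub].
rewrite -lecR (RRe_real (normr_real _)) => /le_trans; apply.
by rewrite ger0_norm // lecR ltW.
Qed.

(** * Random subsets with elementwise inclusion probabilities *)

(** Unequal probabilities turn conditioning on one element into a change of [pi] at that element. *)
Definition subset_prob {R : realType} {U : finType} (pi : U -> R)
    (Q : {set U} -> Prop) : R :=
  \sum_(X : {set U} | `[< Q X >]) \prod_f (if f \in X then pi f else 1 - pi f).

Lemma random_subset_probE (R : realType) (U : finType) (E : {set U}) (p : R)
    (Q : {set U} -> Prop) :
  random_subset_prob E p Q =
  subset_prob (fun f => if f \in E then p else 0) Q.
Proof.
rewrite /subset_prob (bigID (fun X : {set U} => X \subset E)) /=.
rewrite [X in _ + X]big1 ?addr0 => [|X /andP[_ /subsetPn[f fX fE]]]; last first.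
  by rewrite (bigD1 f) //= fX (negPf fE) mul0r.
apply: eq_big => [X|X /andP[/fintype.subsetP sXE _]]; first exact: andbC.
rewrite big_mkcond; apply: eq_bigr => f _.
case: ifP => // fE; case: ifP => [/sXE|]; last by rewrite subr0.
by rewrite fE.
Qed.

Lemma subset_prob_ge0 (R : realType) (U : finType) (pi : U -> R)
    (Q : {set U} -> Prop) :
  (forall f, 0 <= pi f <= 1) -> 0 <= subset_prob pi Q.
Proof.
move=> pi01; apply: sumr_ge0 => X _; apply: prodr_ge0 => f _.
by case: ifP => _; have /andP[] := pi01 f; rewrite ?subr_ge0.
Qed.

(** The probability is affine in [pi f]. *)
Lemma subset_prob_split (R : realType) (U : finType) (pi : U -> R)
    (Q : {set U} -> Prop) (f : U) (x y th : R) :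
  pi f = (1 - th) * x + th * y ->
  subset_prob pi Q = (1 - th) * subset_prob [eta pi with f |-> x] Q
                     + th * subset_prob [eta pi with f |-> y] Q.
Proof.
move=> pif; rewrite /subset_prob !mulr_sumr -big_split; apply: eq_bigr => X _ /=.
have restE z : \prod_(g | g != f) (if g \in X then [eta pi with f |-> z] g
                                   else 1 - [eta pi with f |-> z] g)
             = \prod_(g | g != f) (if g \in X then pi g else 1 - pi g).
  by apply: eq_bigr => g /negPf gf /=; rewrite gf.
rewrite !(bigD1 f (P := predT)) //= !restE eqxx pif.
by case: ifP => _; ring.
Qed.

(** Sets missing an element of probability one have weight zero, and all weights sum to one. *)
Lemma subset_prob_certain (R : realType) (U : finType) (pi : U -> R)
    (Q : {set U} -> Prop) :
  (forall X : {set U}, (forall f, pi f = 1 -> f \in X) -> Q X) ->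
  subset_prob pi Q = 1.
Proof.
move=> QX; transitivity (\prod_f (pi f + (1 - pi f))); last first.
  by apply: big1 => f _; ring.
rewrite bigA_distr [RHS](bigID (fun X => `[< Q X >])) /=.
rewrite [X in _ = _ + X]big1 ?addr0 // => X /asboolPn NQ.
have [f fX pif] : exists2 f, f \notin X & pi f = 1.
  apply: contrapT => Nf; apply/NQ/QX => f pif; apply: contrapT => /negP fX.
  by apply: Nf; exists f.
by rewrite (bigD1 f) //= (negPf fX) pif subrr mul0r.
Qed.

Lemma subset_prob_ge_certain (R : realType) (U : finType) (pi : U -> R)
    (Q : {set U} -> Prop) (g : U) :
  (forall f, 0 <= pi f <= 1) ->
  (forall X : {set U}, g \in X -> (forall f, pi f = 1 -> f \in X) -> Q X) ->
  pi g <= subset_prob pi Q.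
Proof.
move=> pi01 QX; rewrite (@subset_prob_split _ _ _ _ g 0 1 (pi g)); last by ring.
rewrite [X in _ + _ * X]subset_prob_certain => [|X pX]; last first.
  apply: QX => [|f pif]; apply: pX => /=; first by rewrite eqxx.
  by rewrite pif; case: ifP.
rewrite mulr1 lerDr mulr_ge0 ?subset_prob_ge0 ?subr_ge0 //.
  by have /andP[] := pi01 g.
by move=> f /=; case: ifP; rewrite ?lexx ?ler01.
Qed.

(** * Exploration of an open cluster *)

(** Edges already found open are recorded by probability one. *)
Definition sure_rel {R : realType} {T : finType} (e : rel T)
    (pi : {set T} -> R) (W : {set T}) : rel T :=
  [rel x y | [&& x \in W, y \in W, e x y & pi [set x; y] == 1]].

(** A simple path from [w] to [y] inside [W] is closed up through [x]; [w != y] ensures three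
    vertices. *)
Lemma closing_circuit (R : realType) (T : finType) (e : rel T)
    (pi : {set T} -> R) (W : {set T}) (w x y : T) (X : {set {set T}}) :
  symmetric e -> w \in W -> w != y -> x \notin W -> e w x -> e x y ->
  connect (sure_rel e pi W) w y ->
  (forall a b, a \in W -> b \in W -> pi [set a; b] = 1 -> [set a; b] \in X) ->
  [set w; x] \in X -> [set x; y] \in X -> contains_circuit e X.
Proof.
move=> syme wW wy xW ewx exy /connectP[q0 pq0 yE] WX wxX xyX; move: wy exy xyX.
rewrite {y}yE; case/shortenP: pq0 => q pq uq _ wy exy xyX.
have qW : all (mem W) (w :: q).
  rewrite /= wW /=; elim: q w wW {wy ewx wxX exy xyX uq} pq => //= z q IH w wW.
  by case/andP=> /and4P[_ zW _ _] pq; rewrite zW (IH z).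
pose eX := [rel a b | e a b && ([set a; b] \in X)].
have cX : cycle eX [:: x, w & q].
  rewrite /= rcons_path syme ewx finset.setUC wxX /=; apply/andP; split.
    apply: sub_path pq => a b /and4P[aW bW eab /eqP pab] /=.
    by rewrite eab WX.
  by rewrite /= syme exy finset.setUC.
exists [:: x, w & q].
  split; first by case: q wy {pq uq qW cX exy xyX} => //=; rewrite eqxx.
  apply/andP; split.
    by apply: sub_cycle cX => a b /andP[].
  rewrite cons_uniq uq andbT; apply: contra xW => xq.
  exact: (allP qW).
by apply/fintype.subsetP => _ /imsetP[z zc ->]; have /andP[] := next_cycle cX zc.
Qed.

(* Two-round exposure: an edge is open with probability [p1] when first tested,
   and [r] is its probability of being open after a failed test.  [W] is the set
   of vertices reached so far, [F] contains only untested edges, [U] is the set of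
   arcs waiting to be tested, and [pi f] is the conditional probability of [f].
   Reaching a vertex with a second neighbour in [W] leaves an edge of conditional
   probability at least [r] that closes a circuit; until then the exploration is
   a branching process, whose survival probability [t] bounds from below. *)
Lemma explore_circuit (R : realType) (T : finType) (e : rel T) (p1 r : R)
    (t : T * T -> R) :
  symmetric e -> irreflexive e -> 0 <= p1 <= 1 -> 0 <= r <= 1 ->
  (forall b, 0 <= t b <= 1) ->
  (forall w x, e w x ->
     t (w, x) <= p1 * (1 - \prod_(y | e x y && (y != w)) (1 - t (x, y)))) ->
  forall (n : nat) (F : {set {set T}}) (W : {set T}) (U : {set T * T})
    (pi : {set T} -> R),
  (#|F| < n)%N ->
  (forall f, 0 <= pi f <= 1) ->
  (forall f, f \in F -> pi f = (1 - p1) * r + p1) ->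
  (forall x y, e x y -> r <= pi [set x; y]) ->
  (forall b, b \in U ->
     [/\ e b.1 b.2, b.1 \in W, b.2 \notin W & [set b.1; b.2] \in F]) ->
  (forall x y, e x y -> x \notin W -> y \notin W -> [set x; y] \in F) ->
  (forall x y, x \in W -> y \in W -> connect (sure_rel e pi W) x y) ->
  r * (1 - \prod_(b in U) (1 - t b)) <= subset_prob pi (contains_circuit e).
Proof.
move=> syme irre /andP[p10 p11] /andP[r0 r1] t01 tS; elim=> // n IH F W U pi Fn pi01.
move=> piF pir UW fresh conn.
have [->|/finset.set0Pn[[w x] bU]] := eqVneq U finset.set0.
  by rewrite big_set0 subrr mulr0 subset_prob_ge0.
have [/= ewx wW xW fF] := UW _ bU; set f := [set w; x] in fF.
have wf : w \in f by rewrite !inE eqxx.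
have xf : x \in f by rewrite !inE eqxx orbT.
(* No other waiting arc carries [f]: the endpoint in [W] fixes the orientation. *)
have UF b : b \in U :\ (w, x) -> [set b.1; b.2] != f.
  case: b => w' x' /finset.setD1P[/= b'b /UW[/= _ w'W x'W _]].
  apply: contraNneq b'b => E; move: wf xf; rewrite -E !inE.
  case/orP=> /eqP ww; last by rewrite ww (negPf x'W) in wW.
  case/orP=> /eqP xx; first by rewrite xx w'W in xW.
  by rewrite -ww -xx.
have Wf a b : a \in W -> b \in W -> [set a; b] != f.
  move=> aW bW; apply: contraNneq xW => E; move: xf; rewrite -E !inE.
  by case/orP=> /eqP->.
have NWf a b : a \notin W -> b \notin W -> [set a; b] != f.
  move=> aW bW; apply/negP => /eqP E; move: wf; rewrite -E !inE.
  by case/orP=> /eqP E'; move: wW; rewrite E'; apply/negP.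
have FDn : (#|F :\ f| < n)%N by move: Fn; rewrite (cardsD1 f) fF.
have conn' z : forall a b, a \in W -> b \in W ->
    connect (sure_rel e [eta pi with f |-> z] W) a b.
  move=> a b aW bW; have := conn a b aW bW; apply: connect_sub => a' b'.
  case/and4P=> a'W b'W eab pab; apply: connect1.
  by rewrite /sure_rel /= a'W b'W eab (negPf (Wf _ _ a'W b'W)).
have pi'01 z : 0 <= z <= 1 -> forall g, 0 <= [eta pi with f |-> z] g <= 1.
  by move=> z01 g /=; case: ifP.
(* Test [f]: it opens with probability [p1], and after a failure keeps probability [r]. *)
rewrite (@subset_prob_split _ _ _ _ f r 1 p1) ?mulr1 ?piF //.
set A := \prod_(b in U :\ (w, x)) (1 - t b).
have A0 : 0 <= A.
  by apply: prodr_ge0 => b _; rewrite subr_ge0; case/andP: (t01 b).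
rewrite (big_setD1 _ bU) /= -/A.
have closed : r * (1 - A) <=
    subset_prob [eta pi with f |-> r] (contains_circuit e).
  apply: (IH (F :\ f) W) => //.
  - by apply: pi'01; rewrite r0.
  - by move=> g /finset.setD1P[/negPf gf /piF] /=; rewrite gf.
  - by move=> a b /pir /=; case: ifP.
  - move=> b bU'; have /UW[? ? ? ?] : b \in U by case/finset.setD1P: bU'.
    by split=> //; rewrite !inE UF.
  - by move=> a b eab aW bW; rewrite !inE NWf // fresh.
  - exact: conn'.
set S := \prod_(y | e x y && (y != w)) (1 - t (x, y)) in tS *.
have S0 : 0 <= S.
  by apply: prodr_ge0 => y _; rewrite subr_ge0; case/andP: (t01 (x, y)).
have pi1 : 0 <= (1 : R) <= 1 by rewrite ler01 lexx.
have opened : r * (1 - A * S) <=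
    subset_prob [eta pi with f |-> 1] (contains_circuit e).
  have [y /and3P[yW yw exy]|Ny] := pickP [pred y | [&& y \in W, y != w & e x y]].
    have gf : [set x; y] != f.
      apply: contraNneq yw => E; have : y \in f by rewrite -E !inE eqxx orbT.
      rewrite !inE => /orP[//|/eqP E']; by rewrite -E' yW in xW.
    apply: le_trans (_ : [eta pi with f |-> 1] [set x; y] <= _).
      rewrite /= (negPf gf) (le_trans _ (pir _ _ exy)) //.
      by rewrite ler_piMr // gerBl mulr_ge0.
    apply: subset_prob_ge_certain; first exact: pi'01.
    move=> X xyX piX.
    apply: (@closing_circuit _ _ _ [eta pi with f |-> 1] W w x y) => //.
    - by rewrite eq_sym.
    - exact: conn'.
    - by move=> a b _ _ /piX.
    - by apply: piX; rewrite /= eqxx.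
  have NyW y : e x y -> y != w -> y \notin W.
    by move=> exy yw; apply/negP => yW; have := Ny y; rewrite /= yW yw exy.
  have succF y : e x y -> y != w -> [set x; y] \in F :\ f.
    move=> exy yw; have yW := NyW _ exy yw.
    by rewrite !inE NWf // fresh.
  pose V := [set b : T * T | [&& b.1 == x, e x b.2 & b.2 != w]].
  have VE : \prod_(b in V) (1 - t b) = S.
    rewrite /S (reindex_onto (fun y => (x, y)) snd) /=; last first.
      by move=> [a b]; rewrite inE => /and3P[/= /eqP->].
    by apply: eq_bigl => y; rewrite inE /= eqxx eqxx andbT.
  have UV : [disjoint U :\ (w, x) & V].
    apply/pred0P => -[a b] /=; apply/negP => /andP[/finset.setD1P[_ /UW[/= _ aW _ _]]].
    by rewrite inE /= => /andP[/eqP ax _]; rewrite ax (negPf xW) in aW.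
  have -> : A * S = \prod_(b in (U :\ (w, x)) :|: V) (1 - t b).
    by rewrite -VE -bigU //; apply: eq_bigl => b; rewrite !inE.
  apply: (IH (F :\ f) (x |: W)) => //.
  - exact: pi'01.
  - by move=> g /finset.setD1P[/negPf gf /piF] /=; rewrite gf.
  - by move=> a b /pir /=; case: ifP.
  - move=> [a b] /finset.setUP[bU'|].
      have /UW[/= eab aW bW abF] : (a, b) \in U by case/finset.setD1P: bU'.
      split=> //=; rewrite !inE ?aW ?orbT //; last by rewrite (UF _ bU').
      (* A waiting arc ending at [x] would start at a second neighbour of [x] in [W]. *)
      rewrite (negPf bW) orbF; apply/negP => /eqP bx; subst b.
      have /negP := Ny a; apply; rewrite /= aW syme eab andbT.
      by case/finset.setD1P: bU' => /negP ab _; apply/negP => /eqP aw; case: ab; rewrite aw.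
    rewrite inE => /and3P[/= /eqP-> exb bw]; split=> //; rewrite ?inE ?eqxx //.
      by rewrite negb_or NyW // andbT; apply: contraTneq exb => ->; rewrite irre.
    by have := succF _ exb bw; rewrite !inE.
  - move=> a b eab; rewrite !in_setU1 !negb_or => /andP[_ aW] /andP[_ bW].
    by rewrite !inE NWf // fresh.
  - have sWW : subrel (connect (sure_rel e [eta pi with f |-> 1] W))
        (connect (sure_rel e [eta pi with f |-> 1] (x |: W))).
      apply: connect_sub => a b /and4P[aW bW eab pab]; apply: connect1.
      by rewrite /sure_rel /= !in_setU1 aW bW eab !orbT.
    have step : sure_rel e [eta pi with f |-> 1] (x |: W) w x.
      by rewrite /sure_rel /= !in_setU1 eqxx wW ewx -/f eqxx eqxx orbT.
    have stepC : sure_rel e [eta pi with f |-> 1] (x |: W) x w.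
      by rewrite /sure_rel /= !in_setU1 eqxx wW syme ewx finset.setUC -/f eqxx eqxx orbT.
    have toW a : a \in x |: W ->
        connect (sure_rel e [eta pi with f |-> 1] (x |: W)) a w.
      case/setU1P=> [->|aW]; first exact: connect1.
      by apply: sWW; apply: conn'.
    have fromW a : a \in x |: W ->
        connect (sure_rel e [eta pi with f |-> 1] (x |: W)) w a.
      case/setU1P=> [->|aW]; first exact: connect1.
      by apply: sWW; apply: conn'.
    by move=> a b /toW aw /fromW; apply: connect_trans.
have := tS _ _ ewx; rewrite -/S => tb.
have tbA : A * t (w, x) <= A * (p1 * (1 - S)) by rewrite ler_wpM2l.
(* The average is [r * (1 - A + A * (p1 * (1 - S)))], and [tbA] bounds its last term below by
   [A * t (w, x)]. *)
apply: (@le_trans _ _ ((1 - p1) * (r * (1 - A)) + p1 * (r * (1 - A * S)))).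
  have -> : (1 - p1) * (r * (1 - A)) + p1 * (r * (1 - A * S))
     = r * (1 - A + A * (p1 * (1 - S))) by ring.
  by rewrite ler_wpM2l //; lra.
by rewrite lerD // ler_wpM2l // subr_ge0.
Qed.

(** * Nonbacktracking matrix *)

Lemma mul_nb_matrixE (R : realType) (T : finType) (e : rel T)
    (x : 'rV[R]_#|Defs.arc e|) (a : Defs.arc e) :
  simple_graph e ->
  (x *m nb_matrix e R) 0 (enum_rank a) =
  \sum_(y | e (val a).1 y && (y != (val a).2))
     x 0 (enum_rank (insubd a (y, (val a).1))).
Proof.
case=> syme irre; rewrite mxE (reindex_onto enum_rank enum_val) /=; last first.
  by move=> i _; rewrite enum_valK.
rewrite (eq_bigl xpredT) => [|c]; last by rewrite enum_rankK eqxx.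
under eq_bigr do rewrite mxE !enum_rankK.
transitivity (\sum_(c : Defs.arc e | nonbacktracking c a) x 0 (enum_rank c)).
  rewrite [RHS]big_mkcond; apply: eq_bigr => c _.
  by case: ifP => _; rewrite ?mulr1 ?mulr0.
rewrite (reindex_onto (fun y => insubd a (y, (val a).1)) (fun c => (val c).1)).
  apply: eq_bigl => y; rewrite /nonbacktracking val_insubd /=.
  (* For [y] not adjacent, [insubd] returns [a], which does not follow itself since no arc is a
     loop. *)
  have ea : (val a).1 == (val a).2 = false.
    by apply: contraTF (valP a) => /eqP->; rewrite irre.
  by rewrite [e y _]syme; case: ifP => _ /=; rewrite ?eqxx ?ea ?andbT.
by move=> c /andP[/eqP ac _]; rewrite ac -surjective_pairing valKd.
Qed.

(** Minimum degree two gives each arc a nonbacktracking predecessor, so the all-ones vector is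
    subinvariant at [1] and the junk value is excluded. *)
Lemma nb_matrix_perron (R : realType) (T : finType) (e : rel T) :
  simple_graph e -> (0 < #|T|)%N -> min_degree_ge e 2 ->
  is_perron_eigenvalue (nb_matrix e R) (perron_eigenvalue (nb_matrix e R)).
Proof.
move=> simple_e /card_gt0P[x0 _] deg2; apply: xgetPex.
have other x w : exists y, e x y && (y != w).
  have : (0 < #|[set y | e x y] :\ w|)%N.
    have := deg2 x; rewrite /degree (cardsD1 w); case: (_ \in _) => //=.
    by move=> /ltnW.
  by case/card_gt0P=> y; rewrite !inE andbC; exists y.
apply: perron_eigenvalue_exists => [i j|]; first by rewrite mxE ler0n.
exists (const_mx 1); split.
- by move=> j; rewrite mxE.
- have [y /andP[exy _]] := other x0 x0.
  have a : Defs.arc e := Sub (x0, y) exy.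
  by apply/rV0Pn; exists (enum_rank a); rewrite mxE oner_eq0.
move=> j; rewrite -[j]enum_valK mul_nb_matrixE // mxE mulr1.
have [y ey] := other (val (enum_val j)).1 (val (enum_val j)).2.
rewrite (bigD1 y) //= mxE lerDl sumr_ge0 // => z _.
by rewrite mxE ler01.
Qed.

(* The arc [(w, x)], explored from [w] to [x], carries the weight of the reversed
   arc [(x, w)] because [eigenvalue] refers to row eigenvectors. *)
Lemma nb_matrix_arc_weights (R : realType) (T : finType) (e : rel T) (l : R) :
  simple_graph e -> is_perron_eigenvalue (nb_matrix e R) l ->
  exists u : T * T -> R,
    [/\ forall b, 0 <= u b <= 1, exists2 b, e b.1 b.2 & u b = 1
      & forall w x, e w x ->
          l * u (w, x) <= \sum_(y | e x y && (y != w)) u (x, y)].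
Proof.
move=> simple_e [l0 el _]; have [syme irre] := simple_e.
have B0 i j : 0 <= nb_matrix e R i j by rewrite mxE ler0n.
have [z [z0 /rV0Pn[i zi] zB]] := eigenvalue_subinvariant _ _ _ _ B0 el.
have {}zB j : l * z 0 j <= (z *m nb_matrix e R) 0 j.
  suff <- : complex.Re `|(l%:C)%C| = l by exact: zB.
  by rewrite ger0_norm // ler0c ltW.
(* Dividing by the largest coordinate gives weights at most one, with one attained. *)
case: (arg_maxP (fun j => z 0 j) (isT : xpredT i)) => m _ zm.
have zm0 : 0 < z 0 m.
  by apply: lt_le_trans (zm i isT); rewrite lt_def zi z0.
pose u (b : T * T) : R :=
  if (insub (b.2, b.1) : option (Defs.arc e)) is Some a
  then z 0 (enum_rank a) / z 0 m else 0.
have uE w x (a : Defs.arc e) : val a = (x, w) -> u (w, x) = z 0 (enum_rank a) / z 0 m.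
  by move=> av; rewrite /u /= -av valK.
exists u; split.
- move=> b; rewrite /u; case: insub => [a|]; last by rewrite lexx ler01.
  by rewrite divr_ge0 ?z0 /= ?ler_pdivrMr // mul1r; apply: zm.
- exists ((val (enum_val m)).2, (val (enum_val m)).1) => /=.
    by rewrite syme; apply: (valP (enum_val m)).
  rewrite (uE _ _ (enum_val m)); last exact: surjective_pairing.
  by rewrite enum_valK divff // gt_eqF.
move=> w x ewx; have exw : e (x, w).1 (x, w).2 by rewrite /= syme.
pose a : Defs.arc e := Sub (x, w) exw.
rewrite (uE _ _ a) // mulrA ler_pdivrMr // (le_trans (zB _)) //.
rewrite mul_nb_matrixE // mulr_suml; apply: ler_sum => y /andP[/= exy _].
rewrite (uE _ _ (insubd a (y, x))) ?divfK ?gt_eqF //.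
by rewrite val_insubd /= syme exy.
Qed.

(** * Survival inequality and conclusion *)

(** The induction rests on [(1 - t) * (1 + t + y) <= 1 + y] for [t, y >= 0]. *)
Lemma prodr_onem_le (R : realType) (I : finType) (P : pred I) (t : I -> R) :
  (forall i, 0 <= t i <= 1) ->
  0 <= \prod_(i | P i) (1 - t i) /\
  \prod_(i | P i) (1 - t i) * (1 + \sum_(i | P i) t i) <= 1.
Proof.
move=> t01; suff [? _ ?] : [/\ 0 <= \prod_(i | P i) (1 - t i),
  0 <= \sum_(i | P i) t i &
  \prod_(i | P i) (1 - t i) * (1 + \sum_(i | P i) t i) <= 1] by [].
apply: (big_rec2 (fun x y : R => [/\ 0 <= x, 0 <= y & x * (1 + y) <= 1])).
  by split=> //; rewrite addr0 mulr1.
move=> i x y _ [x0 y0 xy1]; have /andP[ti0 ti1] := t01 i.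
split; [by rewrite mulr_ge0 ?subr_ge0 | exact: addr_ge0 |].
have -> : (1 - t i) * x * (1 + (t i + y)) =
  x * (1 + y) - x * (t i * t i) - x * (t i * y) by ring.
have : 0 <= x * (t i * t i) by rewrite !mulr_ge0.
have : 0 <= x * (t i * y) by rewrite !mulr_ge0.
lra.
Qed.

Theorem theorem4p1 (R : realType) (T : finType) (e : rel T)
    (simple_e : simple_graph e) (connected_e : connected_graph e)
    (min_degree_e : min_degree_ge e 2) (eps p : R) (eps_gt0 : 0 < eps)
    (p_ge : 1 / perron_eigenvalue (nb_matrix e R) + eps <= p) (p_le1 : p <= 1) :
  eps ^+ 2 / 4 <= random_subset_prob (edges e) p (contains_circuit e).
Proof.
have [T0 _] := connected_e; have [syme irre] := simple_e.
have Pl := nb_matrix_perron R T e simple_e T0 min_degree_e.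
set l := perron_eigenvalue _ in p_ge Pl; have [l0 _ _] := Pl.
have [u [u01 [[w x] /= ewx uwx] ul]] := nb_matrix_arc_weights _ _ _ _ simple_e Pl.
have li0 : 0 < 1 / l by rewrite divr_gt0.
pose h := eps / 2; have h0 : 0 < h by rewrite divr_gt0.
have epsE : eps = 2 * h by rewrite /h; field.
(* [r] solves [p = (1 - p1) * r + p1], so the two rounds together open an edge with probability
   [p]. *)
pose p1 := p - h; pose r := h / (1 - p1); pose t b := h * u b.
have p1l : 1 + h * l <= p1 * l.
  have : (1 / l + h) * l <= p1 * l by apply: ler_wpM2r; [exact: ltW | rewrite /p1; lra].
  by rewrite mulrDl divfK ?gt_eqF.
have p1p : 0 < 1 - p1 by rewrite /p1; lra.
have p101 : 0 <= p1 <= 1 by rewrite /p1; lra.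
have rE : p = (1 - p1) * r + p1.
  by rewrite /r mulrC divfK ?gt_eqF // /p1; ring.
have hr : h <= r.
  by rewrite /r ler_pdivlMr // ler_piMr ?(ltW h0) // /p1; lra.
have r01 : 0 <= r <= 1.
  by rewrite (le_trans (ltW h0) hr) /r ler_pdivrMr // mul1r /p1; lra.
have rp : r <= p.
  rewrite rE; have : 0 <= p1 * (1 - r) by apply: mulr_ge0; lra.
  lra.
have th b : 0 <= t b <= h.
  by have /andP[ub0 ub1] := u01 b; rewrite /t mulr_ge0 ?ler_piMr ?(ltW h0).
have t01 b : 0 <= t b <= 1 by have := th b; lra.
(* A single starting arc of weight one yields [r * h >= h * h = eps ^+ 2 / 4]. *)
apply: (@le_trans _ _ (r * (1 - \prod_(b in [set (w, x)]) (1 - t b)))).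
  rewrite big_set1 /t uwx mulr1 opprB addrCA subrr addr0.
  rewrite epsE; have : h * h <= r * h by rewrite ler_wpM2r // ltW.
  by rewrite expr2; lra.
rewrite random_subset_probE.
have edgeE a b : e a b -> [set a; b] \in edges e.
  by move=> eab; apply/imsetP; exists (a, b); rewrite ?inE.
apply: (explore_circuit _ _ _ p1 r t syme irre p101 r01 t01 _ #|edges e|.+1
  (edges e) [set w]) => //.
(* Two bounds are chained: [s * (1 + l * s) <= p1 * l * s], from [s <= h] and [p1l], and
   [l * s <= (1 - P) * (1 + l * s)], from [Pls]. *)
- move=> a b eab; set P := \prod_(_ | _) _.
  have [P0 PS] := prodr_onem_le _ _ (fun y => e b y && (y != a))
    (fun y => t (b, y)) (fun y => t01 (b, y)).
  have lt : l * t (a, b) <= \sum_(y | e b y && (y != a)) t (b, y).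
    by rewrite /t mulrCA -mulr_sumr ler_wpM2l ?ul // ltW.
  rewrite -/P in P0 PS; set S := \sum_(_ | _) _ in PS lt.
  have /andP[t0 tle] := th (a, b); set s := t _ in lt t0 tle *.
  have ls0 : 0 < 1 + l * s by rewrite ltr_pwDl // mulr_ge0 // ltW.
  have Pls : P * (1 + l * s) <= 1.
    by apply: le_trans PS; rewrite ler_wpM2l // lerD2l.
  rewrite -(ler_pM2r ls0); apply: (@le_trans _ _ (p1 * l * s)).
    rewrite mulrC ler_wpM2r // (le_trans _ p1l) // lerD2l mulrC.
    by rewrite ler_wpM2r // ltW.
  have : p1 * (l * s) <= p1 * ((1 - P) * (1 + l * s)).
    by rewrite ler_wpM2l; lra.
  by rewrite !mulrA.
- by move=> f; case: ifP => _; rewrite ?lexx ?ler01 //; lra.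
- by move=> f ->.
- by move=> a b /edgeE ->.
- move=> b /set1P->; rewrite /= inE eqxx edgeE //; split=> //.
  by rewrite inE; apply: contraTneq ewx => ->; rewrite irre.
- by move=> a b /edgeE.
- by move=> a b /set1P-> /set1P->; apply: connect0.
Qed.
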